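(* Let $X, Y$ be topological spaces, let $f : X \to Y$ be a function and let $p \in X$ be a point. Then the following are equivalent. (1) $f$ is multi-split continuous at $p$. (2) There exists a non-empty finite subset $Z \subseteq Y$ such that for every neighborhood $V \subseteq Y$ of $Z$ there exists a neighborhood $U \subseteq X$ of $p$ with $f(U) \subseteq V$.
   Context: A neighborhood of a point $p$ (respectively of a subset $S$) in a topological space is a set $V$, not necessarily open, for which there is an open set $U$ with $p \in U \subseteq V$ (respectively $S \subseteq U \subseteq V$). Let $f : X \to Y$ be a function between topological spaces and $p \in X$. The function $f$ is multi-split continuous at $p$ if there exists a finite non-empty set $Z_p \subseteq Y$ such that: (a) for every $y \in Z_p$ and all neighborhoods $U \subseteq X$ of $p$ and $V \subseteq Y$ of $y$ one has $f(U) \cap V \neq \varnothing$; (b) for every neighborhood $V \subseteq Y$ of the set $Z_p$ there exists a neighborhood $U \subseteq X$ of $p$ with $f(U) \subseteq V$. *)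

(* Defs.v *)
From mathcomp Require Import all_boot all_order all_algebra.
From mathcomp Require Import all_classical topology.

Set Implicit Arguments.
Unset Strict Implicit.
Unset Printing Implicit Defensive.

Local Open Scope classical_set_scope.

(* [nbhs p U] and [set_nbhs Z V] range over all, not only open, neighborhoods:
   by [set_nbhsP], [set_nbhs Z V] holds iff [Z `<=` C `<=` V] for an open [C]. *)
Definition multi_split_continuous_at (X Y : topologicalType) (f : X -> Y)
    (p : X) : Prop :=
  exists Z : set Y,
    [/\ finite_set Z,
        Z !=set0,
        forall y, Z y -> forall (U : set X) (V : set Y),
          nbhs p U -> nbhs y V -> (f @` U) `&` V !=set0 &
        forall V : set Y, set_nbhs Z V ->
          exists U : set X, nbhs p U /\ f @` U `<=` V].

(* Main.v *)
Require Import Defs.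
From mathcomp Require Import all_boot all_order all_algebra.
From mathcomp Require Import all_classical topology.

Local Open Scope classical_set_scope.

(** The condition common to both sides says that the image filter [f @ p]
    contains every neighborhood of [Z]; multi-split continuity also asks that
    every point of [Z] be a cluster point of [f @ p]. The points of [Z] that are
    not cluster points can simply be discarded: each of them has a neighborhood
    avoided by [f] near [p], so it does not help to catch the values of [f] near
    [p], and finitely many such avoidances hold simultaneously near [p].
    [set_nbhs_cluster] is this pruning for compact sets and proper filters.
    Some point survives, since otherwise the empty set would be a neighborhood
    of what is left, hence would contain the values of [f] near [p]. *)

(** Fix a neighborhood [V] of the pruned set. Around any point of [K], the local
    part of every sufficiently small [G] in [F] lies in [V]: either [V] is a
    neighborhood of the point, or the point is not a cluster point and [G]
    misses it locally. By compactness a single [G] serves all of [K], so on a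
    whole neighborhood of [K] membership in [G] forces membership in [V]. That
    neighborhood is in [F] by assumption, and meeting it with [G] gives [V]. *)
Lemma set_nbhs_cluster (T : topologicalType) (F : set_system T) (K : set T) :
  ProperFilter F -> compact K -> set_nbhs K `<=` F ->
  set_nbhs (K `&` cluster F) `<=` F.
Proof.
move=> FF /compact_near_coveringP Kcov KF V nbV.
have local x : K x ->
    \forall y \near x & G \near powerset_filter_from F,
      \forall z \near y, G z -> V z.
  move=> Kx; have [clx|] := pselect (cluster F x).
    have Vx : nbhs x V by exact: nbV.
    exists (nbhs^~ V, setT).
      split; first by move/nbhs_interior: Vx.
      exact: filterT.
    by case=> y G [/= Vy _]; apply: filterS Vy.
  move=> /existsNP[A] /existsNP[B] /not_implyP[FA] /not_implyP[Bx].
  move=> /nonemptyPn AB0.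
  exists (nbhs^~ B, [set G | G `<=` A]).
    split; first by move/nbhs_interior: Bx.
    exact: small_set_sub.
  case=> y G [/= By GA]; apply: filterS By => z Bz /GA Az.
  by have : (A `&` B) z by []; rewrite AB0.
have := Kcov _ _ _ _ local => -[M [MF Msub [G MG]] MK].
have FGV : F [set z | G z -> V z] by apply: KF => y Ky; exact: (MK G MG y Ky).
by apply: filterS (filterI (MF G MG) FGV) => z [Gz]; apply.
Qed.

Theorem proposition3p3 (X Y : topologicalType) (f : X -> Y) (p : X) :
  multi_split_continuous_at f p <->
  exists Z : set Y,
    [/\ finite_set Z,
        Z !=set0 &
        forall V : set Y, set_nbhs Z V ->
          exists U : set X, nbhs p U /\ f @` U `<=` V].
Proof.
split=> [[Z [finZ Z0 _ Zb]]|[Z [finZ _ Zb]]]; first by exists Z.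
have ZF : set_nbhs Z `<=` f @ p.
  move=> V /Zb[U [pU fUV]].
  by apply: filterS pU => x Ux; apply: fUV; exists x.
have prune := set_nbhs_cluster _ _ _ _ (finite_compact finZ) ZF.
exists (Z `&` cluster (f @ p)); split.
- by apply: sub_finite_set finZ => y [].
- apply/set0P/negP => /eqP Z'0.
  have : (f @ p) set0 by apply: prune; rewrite Z'0 => y [].
  exact: filter_not_empty.
- move=> y [_ cly] U V pU yV; apply: cly => //.
  by apply: filterS pU => x Ux; exists x.
- move=> V /prune fV; exists (f @^-1` V); split=> //.
  by move=> _ [x Vfx <-].
Qed.
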